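(* For every positive integer $r$ such that $r+1$ is a perfect square, there exist a $1$-planar graph $G$ and a nonempty set $A\subseteq V(G)$ such that $$|\{N^r[v]\cap A\mid v\in V(G)\}|\ \ge\ \frac{2^{\sqrt{r+1}}}{\sqrt{r+1}}\,|A| .$$
   Context: All graphs are finite, simple and undirected. A graph is $1$-planar if it can be drawn in the plane so that every edge crosses at most one other edge. $N^r[v]$ denotes the set of vertices of $G$ at distance at most $r$ from $v$ in $G$. *)

(* Defs.v *)
From mathcomp Require Import all_boot all_order all_algebra.
From mathcomp Require Import boolp classical_sets functions cardinality set_interval.
From mathcomp Require Import reals topology normedtype.

Set Implicit Arguments.
Unset Strict Implicit.
Unset Printing Implicit Defensive.

Import Order.TTheory GRing.Theory Num.Theory numFieldNormedType.Exports.

Record sgraph := SGraph {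
  vertex :> finType;
  adj : rel vertex;
  adj_sym : symmetric adj;
  adj_irr : irreflexive adj }.

Definition edges (G : sgraph) : {set {set G}} :=
  [set e : {set G} | [exists u, exists v, adj u v && (e == [set u; v])]]%SET.

Definition has_path_of_length (G : sgraph) (u v : G) (n : nat) : bool :=
  [exists p : n.-tuple G,
    [&& path (@adj G) u p, last u p == v & uniq (u :: p)]].

(* The length of a shortest path from u to v.  A path has fewer than #|G| edges;
   the value is #|G| when u and v are not connected, which stands for +oo. *)
Definition dist (G : sgraph) (u v : G) : nat :=
  find (has_path_of_length u v) (iota 0 #|G|).

(* connect excludes the pairs at infinite distance, even if #|G| <= r. *)
Definition ball (G : sgraph) (r : nat) (v : G) : {set G} :=
  [set u : G | connect (@adj G) v u && (dist v u <= r)]%SET.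

Local Open Scope ring_scope.
Local Open Scope classical_set_scope.

Definition simple_arc (R : realType) (p q : R * R) (C : set (R * R)) : Prop :=
  exists g : R -> R * R,
    [/\ {within `[0, 1], continuous g}, set_inj `[0, 1] g,
        g 0 = p, g 1 = q & C = g @` `[0, 1]].

(* Edges are drawn as point sets; simple_arc p q and simple_arc q p agree, so
   no orientation of the edges is involved. *)
Record is_drawing (R : realType) (G : sgraph)
    (pos : G -> R * R) (curve : {set G} -> set (R * R)) : Prop := IsDrawing {
  pos_inj : injective pos;
  curve_arc : forall u v : G, adj u v ->
    simple_arc (pos u) (pos v) (curve [set u; v]%SET);
  curve_vertex : forall (e : {set G}) (w : G), e \in edges G ->
    curve e (pos w) -> w \in e;
  curve_finite : forall e f : {set G}, e \in edges G -> f \in edges G ->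
    e != f -> finite_set (curve e `&` curve f) }.

(* Every common point of two edges other than a common end is a crossing; in
   particular a point where they merely touch counts as one. *)
Definition crosses (R : realType) (G : sgraph)
    (pos : G -> R * R) (curve : {set G} -> set (R * R)) (e f : {set G}) : Prop :=
  e != f /\ exists x, [/\ curve e x, curve f x & forall w, x <> pos w].

Definition one_planar (R : realType) (G : sgraph) : Prop :=
  exists (pos : G -> R * R) (curve : {set G} -> set (R * R)),
    is_drawing pos curve /\
    forall e f f' : {set G},
      e \in edges G -> f \in edges G -> f' \in edges G ->
      crosses pos curve e f -> crosses pos curve e f' -> f = f'.

(* Main.v *)
Require Import Defs.
From mathcomp Require Import all_boot all_order all_algebra.
From mathcomp Require Import reals exp.
From mathcomp Require Import zify ring lra.
From mathcomp Require boolp classical_sets cardinality.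
From mathcomp Require topology normedtype.

Set Implicit Arguments.
Unset Strict Implicit.
Unset Printing Implicit Defensive.

Import Order.TTheory GRing.Theory Num.Theory.
Local Open Scope ring_scope.

(** Put [k = sqrt (r + 1)].  The graph carries [k] wires that start at the
    vertices of [A] and run side by side.  The bundle of wires is split into
    two bundles of [k] wires each, [k] times in a row, which gives a binary tree
    of bundles with [2 ^ k] ends.  The ends are in bijection with the subsets of
    [A]: above the end that stands for [S] there is one more vertex, the leaf of
    [S], to which exactly the wires of [S] are joined.

    To split a bundle, every wire forks into a left and a right branch, and the
    order L R L R .. L R of the [2 k] branches is sorted into L .. L R .. R.
    When all adjacent pairs R L are exchanged at the same time, [k - 1] rounds
    suffice: the left branch of wire [i] and the right branch of wire [j < i]
    are exchanged in round [i - j].  A round is one layer of edges, in which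
    every edge crosses at most one other, so the graph is 1-planar
    ([slot_inverted], [wire_graph_one_planar]).

    The [k] splittings take [k (k - 1)] layers; with [k - 1] further layers the
    leaves are at height exactly [(k + 1) (k - 1) = r].  Every edge joins
    consecutive heights, so a walk of length at most [r] from a leaf to a vertex
    of [A], at height 0, descends at each step and therefore never leaves the
    wire that it takes first.  Hence the trace on [A] of the ball of radius [r]
    around the leaf of [S] is [S] ([ball_leaf]).  All [2 ^ k] subsets of the
    [k]-element set [A] are traces, and [2 ^ k = 2 ^ k / k * k].

    For the drawing it is enough to place the vertices at integer heights and to
    draw the edges as straight segments between consecutive heights: two edges
    of a layer then cross only if their ends are in opposite orders at the
    bottom and at the top ([layered_one_planar]). *)

(** * Straight-line drawings in layers *)

Module LayeredDrawing.
Import boolp classical_sets cardinality.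
Import topology normedtype numFieldNormedType.Exports.
Local Open Scope classical_set_scope.

Definition segment (R : realType) (p q : R * R) : set (R * R) :=
  (fun t : R => (p.1 + t * (q.1 - p.1), p.2 + t * (q.2 - p.2))) @` `[0, 1].

Lemma segmentC (R : realType) (p q : R * R) : segment p q = segment q p.
Proof.
suff sub (p' q' : R * R) : segment p' q' `<=` segment q' p'.
  by apply/seteqP; split; apply: sub.
move=> _ [t /= /[!in_itv] /= /andP[t0 t1] <-]; exists (1 - t) => /=.
  by rewrite in_itv /=; apply/andP; split; lra.
by congr (_, _); ring.
Qed.

Lemma segment_arc (R : realType) (p q : R * R) :
  p <> q -> simple_arc p q (segment p q).
Proof.
move=> npq.
exists (fun t : R => (p.1 + t * (q.1 - p.1), p.2 + t * (q.2 - p.2))); split.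
- have affine (a b : R) : continuous (fun t : R => a + t * b).
    move=> t; apply: cvgD; first exact: cvg_cst.
    by apply: cvgM; [exact: cvg_id|exact: cvg_cst].
  apply: continuous_subspaceT => t.
  exact: (cvg_pair (affine _ _ t) (affine _ _ t)).
- move=> s t _ _ [] /addrI e1 /addrI e2.
  apply/eqP; apply: contra_notT npq => nst.
  case: p q e1 e2 => [p1 p2] [q1 q2] /= e1 e2.
  have nst0 : s - t != 0 by rewrite subr_eq0.
  congr (_, _); apply/eqP; rewrite eq_sym -subr_eq0 -(mulrI_eq0 _ (mulfI nst0));
    by rewrite mulrBl ?e1 ?e2 subrr.
- by case: p {npq} => a b /=; rewrite !mul0r !addr0.
- by case: p q {npq} => a b [c d] /=; congr (_, _); ring.
- by [].
Qed.

Lemma set2_inj (T : finType) (u v u' v' : T) :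
  [set u; v]%SET = [set u'; v']%SET ->
  (u = u' /\ v = v') \/ (u = v' /\ v = u').
Proof.
move=> E.
have := set21 u v; have := set22 u v; rewrite E !inE.
have := set21 u' v'; have := set22 u' v'; rewrite -E !inE.
do 4 (case/orP => /eqP ?); subst; by [left|right].
Qed.

Section Layered.
Variables (R : realType) (G : sgraph) (x y : G -> nat).
Hypothesis xy_inj : forall u v, x u = x v -> y u = y v -> u = v.

Definition up_edge (u v : G) := adj u v /\ y v = (y u).+1.

Definition inverted (u v u' v' : G) : Prop :=
  (x u < x u')%N /\ (x v' < x v)%N \/ (x u' < x u)%N /\ (x v < x v')%N.

Hypothesis adj_layers : forall u v, adj u v -> up_edge u v \/ up_edge v u.
Hypothesis inverted_unique : forall u v u1 v1 u2 v2,
  up_edge u v -> up_edge u1 v1 -> up_edge u2 v2 -> y u1 = y u -> y u2 = y u ->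
  inverted u v u1 v1 -> inverted u v u2 v2 -> u1 = u2 /\ v1 = v2.

Definition pos (u : G) : R * R := ((x u)%:R, (y u)%:R).

(** The ends of an edge are not ordered; [curveE] shows that either order gives
    the same segment. *)
Definition curve (e : {set G}) : set (R * R) :=
  [set p | exists u v : G,
     [/\ adj u v, e = [set u; v]%SET & segment (pos u) (pos v) p]].

Lemma pos_inj : injective pos.
Proof.
move=> u v [] /eqP + /eqP; rewrite !eqr_nat => /eqP xE /eqP yE.
exact: xy_inj xE yE.
Qed.

Lemma curveE (u v : G) :
  adj u v -> curve [set u; v]%SET = segment (pos u) (pos v).
Proof.
move=> uv; apply/seteqP; split => [p [u' [v' [_ /set2_inj]]]|p pS].
  by case=> -[<- <-] //; rewrite segmentC.
by exists u, v.
Qed.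

Lemma edges_up (e : {set G}) : e \in edges G ->
  exists u v, up_edge u v /\ e = [set u; v]%SET.
Proof.
rewrite inE => /existsP[u /existsP[v /andP[uv /eqP eE]]].
case: (adj_layers uv) => ?; first by exists u, v.
by exists v, u; rewrite finset.setUC.
Qed.

Lemma mem_curve (u v : G) (p : R * R) : up_edge u v ->
  curve [set u; v]%SET p ->
  exists2 t : R, 0 <= t <= 1 &
    p = ((x u)%:R + t * ((x v)%:R - (x u)%:R), (y u)%:R + t).
Proof.
move=> [uv yE]; rewrite curveE// => -[t /=]; rewrite in_itv /= => t01 <-.
exists t => //; congr (_, _); rewrite yE -addn1 natrD; ring.
Qed.

(** A point common to edges of distinct layers lies on a line of integer height,
    which the lower edge meets in its top vertex only. *)
Lemma curve_common_vertex (u v u' v' : G) (p : R * R) :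
  up_edge u v -> up_edge u' v' -> (y u < y u')%N ->
  curve [set u; v]%SET p -> curve [set u'; v']%SET p -> p = pos v.
Proof.
move=> uv uv' yy /(mem_curve uv)[t /andP[t0 t1] ->].
move=> /(mem_curve uv')[s /andP[s0 s1] []] _ /= E.
have yle : (y u)%:R + 1 <= (y u')%:R :> R.
  by rewrite -[1]/(1%:R) -natrD ler_nat addn1.
have -> : t = 1 by lra.
by case: uv => _ vE; rewrite /pos vE -addn1 natrD; congr (_, _); ring.
Qed.

(** The interior of an edge lies strictly between two consecutive integer
    heights, so it avoids all vertices. *)
Lemma curve_end (u v w : G) : up_edge u v ->
  curve [set u; v]%SET (pos w) -> w = u \/ w = v.
Proof.
move=> uv /(mem_curve uv)[t /andP[t0 t1] [] xE yE].
have yuw : (y u <= y w)%N by rewrite -(ler_nat R); lra.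
have ywu : (y w <= (y u).+1)%N by rewrite -(ler_nat R) -addn1 natrD; lra.
have [yw|/esym yw] : y w = y u \/ (y u).+1 = y w by lia.
  left; have t00 : t = 0 by move: yE; rewrite yw; lra.
  by apply: xy_inj => //; apply/eqP; rewrite -(eqr_nat R) xE t00; apply/eqP; ring.
right; have t11 : t = 1 by move: yE; rewrite yw -addn1 natrD; lra.
apply: xy_inj; last by rewrite yw; case: uv.
by apply/eqP; rewrite -(eqr_nat R) xE t11; apply/eqP; ring.
Qed.

(** Two segments of one layer that meet at two heights have the same slope and
    the same ends; in distinct layers the only common point is a vertex. *)
Lemma curve_subsingleton (u v u' v' : G) (p q : R * R) :
  up_edge u v -> up_edge u' v' -> [set u; v]%SET != [set u'; v']%SET ->
  curve [set u; v]%SET p -> curve [set u'; v']%SET p ->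
  curve [set u; v]%SET q -> curve [set u'; v']%SET q -> p = q.
Proof.
move=> uv uv' ne p1 p2 q1 q2.
have [yy|yy|yE] := ltngtP (y u) (y u').
- by rewrite (curve_common_vertex uv uv' yy p1 p2)
             (curve_common_vertex uv uv' yy q1 q2).
- by rewrite (curve_common_vertex uv' uv yy p2 p1)
             (curve_common_vertex uv' uv yy q2 q1).
have [t _ pE] := mem_curve uv p1; have [t' _ pE'] := mem_curve uv' p2.
have [s _ qE] := mem_curve uv q1; have [s' _ qE'] := mem_curve uv' q2.
move: pE'; rewrite pE yE => -[] xt /addrI tE; subst t'.
move: qE'; rewrite qE yE => -[] xs /addrI sE; subst s'.
have [-> //|nst] := eqVneq t s.
have nts0 : t - s != 0 by rewrite subr_eq0.
have slope : (x v)%:R - (x u)%:R = (x v')%:R - (x u')%:R :> R.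
  by apply: (mulfI nts0); move: xt xs; nra.
have xu : (x u)%:R = (x u')%:R :> R by move: xt; rewrite slope; lra.
have xv : (x v)%:R = (x v')%:R :> R by lra.
case/eqP: ne; congr ([set _; _]%SET); apply: xy_inj => //.
- by apply/eqP; rewrite -(eqr_nat R) xu.
- by apply/eqP; rewrite -(eqr_nat R) xv.
- by case: uv uv' => _ -> [_ ->]; rewrite yE.
Qed.

(** At height [t] above the bottom of the layer, the horizontal distance of the
    edges is the average, with weights [1 - t] and [t], of the distances at the
    bottom and at the top.  It vanishes for some [t] inside the layer, so these
    two distances have opposite signs. *)
Lemma crosses_inverted (u v u' v' : G) :
  up_edge u v -> up_edge u' v' ->
  crosses pos curve [set u; v]%SET [set u'; v']%SET ->
  y u' = y u /\ inverted u v u' v'.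
Proof.
move=> uv uv' [ne [p [p1 p2 np]]].
have yE : y u' = y u.
  have [yy|yy|//] := ltngtP (y u') (y u).
    by case: (np v'); apply: curve_common_vertex uv' uv yy p2 p1.
  by case: (np v); apply: curve_common_vertex uv uv' yy p1 p2.
split=> //.
have yvE : y v' = y v by case: uv uv' => _ -> [_ ->]; rewrite yE.
have [t /andP[t0 t1] pE] := mem_curve uv p1.
have [t' _ pE'] := mem_curve uv' p2.
move: pE'; rewrite pE yE => -[] xt /addrI tE; subst t'.
have tn0 : t != 0.
  apply/eqP => tE; apply: (np u); rewrite pE tE /pos.
  by congr (_, _); ring.
have tn1 : t != 1.
  apply/eqP => tE; apply: (np v); rewrite pE tE /pos.
  by case: uv => _ ->; rewrite -addn1 natrD; congr (_, _); ring.
have {t0}t0 : 0 < t by rewrite lt_neqAle eq_sym tn0.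
have {t1}t1 : t < 1 by rewrite lt_neqAle tn1.
have nE : ~ (x u = x u' /\ x v = x v').
  move=> [xu xv]; case/eqP: ne.
  by congr ([set _; _]%SET); apply: xy_inj.
have bary : (1 - t) * ((x u)%:R - (x u')%:R) + t * ((x v)%:R - (x v')%:R) = 0 :> R.
  by move: xt; nra.
have absurd a b : 0 <= a -> 0 <= b -> 0 < a \/ 0 < b ->
    (1 - t) * a + t * b = 0 -> False.
  by move=> a0 b0 [ab|ab]; nra.
have [xu|xu|xu] := ltngtP (x u) (x u'); have [xv|xv|xv] := ltngtP (x v) (x v');
  try (by left); try (by right); try (by case: nE).
all: exfalso; first
  [apply: (absurd ((x u)%:R - (x u')%:R) ((x v)%:R - (x v')%:R));
     rewrite ?subr_ge0 ?subr_gt0 ?ler_nat ?ltr_nat; try lia; exact: bary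
  |apply: (absurd ((x u')%:R - (x u)%:R) ((x v')%:R - (x v)%:R));
     rewrite ?subr_ge0 ?subr_gt0 ?ler_nat ?ltr_nat; try lia; move: bary; lra].
Qed.

Theorem layered_one_planar : one_planar R G.
Proof.
exists pos, curve; split; first split.
- exact: pos_inj.
- move=> u v uv; rewrite curveE//; apply: segment_arc => /pos_inj uE.
  by move: uv; rewrite uE adj_irr.
- move=> e w /edges_up[u [v [uv ->]]] /(curve_end uv)[]->;
    by rewrite !inE eqxx ?orbT.
- move=> e f /edges_up[u [v [uv ->]]] /edges_up[u' [v' [uv' ->]]] ne.
  have [[p [p1 p2]]|np] :=
    pselect (exists p, (curve [set u; v]%SET `&` curve [set u'; v']%SET) p).
    apply: (sub_finite_set _ (finite_set1 p)) => q [q1 q2] /=.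
    exact: (curve_subsingleton uv uv' ne).
  apply: (sub_finite_set _ (finite_set0 _)) => q qq.
  by case: np; exists q.
- move=> e f f' /edges_up[u [v [uv ->]]] /edges_up[u1 [v1 [uv1 ->]]].
  move=> /edges_up[u2 [v2 [uv2 ->]]].
  move=> /(crosses_inverted uv uv1)[y1 i1] /(crosses_inverted uv uv2)[y2 i2].
  by have [-> ->] := inverted_unique uv uv1 uv2 y1 y2 i1 i2.
Qed.

End Layered.
End LayeredDrawing.
(** * Balls and walks *)

(** Distances are defined by paths without repeated vertices; a walk can be
    shortened to such a path, so arbitrary walks measure the same distance. *)
Lemma ballP (G : sgraph) (r : nat) (v u : G) :
  reflect (exists p, [/\ path (@adj G) v p, last v p = u & (size p <= r)%N])
          (u \in ball r v).
Proof.
have paths_dist p : path (@adj G) v p -> uniq (v :: p) -> last v p = u ->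
    (size p < #|G|)%N /\ has_path_of_length v u (size p).
  move=> vp vU pu; split; first by rewrite -[_.+1]/(size (v :: p)) -(card_uniqP vU) max_card.
  by apply/existsP; exists (in_tuple p); rewrite vp vU pu eqxx.
rewrite inE; apply: (iffP andP) => [[/connectP[p vp uE] vur]|[p [vp pu pr]]].
  have hasd : has (has_path_of_length v u) (iota 0 #|G|).
    move: uE; case/shortenP: vp => p' vp' vU' _ uE.
    have [lt ok] := paths_dist p' vp' vU' (esym uE).
    by apply/hasP; exists (size p') => //; rewrite mem_iota.
  have := nth_find 0 hasd; rewrite nth_iota; last by move: hasd; rewrite has_find size_iota.
  case/existsP => q /and3P[vq /eqP qu _]; exists q; split=> //.
  by rewrite size_tuple.
split; first by apply/connectP; exists p.
move: pu; case/shortenP: vp => p' vp' vU' sub pu.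
have [lt ok] := paths_dist p' vp' vU' pu.
have p'r : (size p' <= r)%N.
  apply: leq_trans pr; apply: uniq_leq_size sub; by case/andP: vU'.
apply: leq_trans p'r; rewrite leqNgt; apply/negP => /(before_find 0).
by rewrite nth_iota// ok.
Qed.

Lemma path_height (T : Type) (e : rel T) (f : T -> nat) (v : T) (p : seq T) :
  (forall u w, e u w -> (f u <= (f w).+1)%N) ->
  path e v p -> (f v <= f (last v p) + size p)%N.
Proof.
move=> ef; elim: p v => [|w p IH] v /=; first by rewrite addn0.
by case/andP => /ef fvw /IH fw; lia.
Qed.

(** * Splitting a bundle of wires *)

Section Construction.
Local Open Scope nat_scope.
Variable n : nat.
Hypothesis n_gt0 : 0 < n.
Notation k := n.+1.
Notation r := (n * n.+2).

(** [n = k - 1] is the number of layers of one splitting.  Layer [h] lies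
   between the heights [h] and [h + 1]; splittings start at the layers
   [0], [n], .., [(k - 1) n]. *)
Definition splits (h : nat) : bool := (n %| h) && (h < k * n).

(** The bundles of one height are numbered from left to right; the two halves of
    bundle [q] get the numbers [2 q] and [2 q + 1].  Thus bundle [q] at height
    [h + 1] continues bundle [parent h q] at height [h]. *)
Definition parent (h q : nat) : nat := if splits h then q./2 else q.

(** The abscissa, at height [h], of wire [i] of bundle [q].  Each bundle owns an
    interval of length [8 k].  During a splitting the halves [q] of even and of
    odd number share the interval of the bundle [q./2] that they come from: the
    even half moves left and the odd half moves right, both at speed 2 past
    wires at distance 4, so that a branch passes at most one
    other branch in each layer.  The displacement is odd, which keeps left and
    right branches apart at integer heights; when the splitting ends, each half
    has an interval of its own, in which its wires have kept their order. *)
Definition slot (h q i : nat) : nat :=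
  if (0 < h %% n) && (h < k * n)
  then q./2 * (8 * k) +
       (4 * i + if odd q then 2 * k + (2 * (h %% n)).+1
                else 2 * k - (2 * (h %% n)).+1)
  else q * (8 * k) + (4 * i + 2 * k).

Lemma ltn_lex (m a b c d : nat) : b < m -> d < m ->
  (a * m + b < c * m + d) = (a < c) || (a == c) && (b < d).
Proof.
move=> bm dm; have [ac|ca|->] := ltngtP a c; last by rewrite ltn_add2l.
- by have := leq_mul2r m a.+1 c; rewrite ac orbT mulSn => le; lia.
- by have := leq_mul2r m c.+1 a; rewrite ca orbT mulSn => le; lia.
Qed.

Lemma ltn_straight (q i q' i' : nat) : i < k -> i' < k ->
  (q * (8 * k) + (4 * i + 2 * k) < q' * (8 * k) + (4 * i' + 2 * k)) =
  (q < q') || (q == q') && (i < i').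
Proof. by move=> ik ik'; rewrite ltn_lex; lia. Qed.

Lemma slot_inj (h q i q' i' : nat) : i < k -> i' < k ->
  slot h q i = slot h q' i' -> q = q' /\ i = i'.
Proof.
move=> ik ik' E; have tn : h %% n < n by rewrite ltn_mod.
have {E} : (slot h q i < slot h q' i') = false /\ (slot h q' i' < slot h q i) = false.
  by rewrite E ltnn.
rewrite /slot; case: ifP => _; last by rewrite !ltn_straight//; lia.
rewrite !ltn_lex; try (case: ifP; lia).
by case: ifP; case: ifP; lia.
Qed.

(** At time [t > 0] of a splitting, the left branch of wire [i'] is still to the
    right of the right branch of wire [i] if [4 i' - (2 t + 1)] exceeds
    [4 i + (2 t + 1)], that is, if [i' - i > t]; at [t = 0] the branches start
    in the order of their wires, which is the same condition.  So the exchange takes place in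
    layer [t] exactly if [i' - i = t + 1].  At the end of the splitting, when
    [t = n], all exchanges have been made because [i' - i <= k - 1 = n]. *)
Lemma slot_inverted (h q i q' i' : nat) : i < k -> i' < k ->
  slot h (parent h q) i < slot h (parent h q') i' ->
  slot h.+1 q' i' < slot h.+1 q i ->
  [&& q./2 == q'./2, odd q, ~~ odd q' & i' == i + (h %% n).+1].
Proof.
move=> ik ik'; have tn : h %% n < n by rewrite ltn_mod.
rewrite /slot /parent /splits.
have [hkn|hkn] := ltnP h (k * n); last first.
  rewrite !andbF (_ : h.+1 < k * n = false) ?andbF; last by lia.
  by rewrite !ltn_straight//; lia.
have hS : h.+1 %% n = if (h %% n).+1 == n then 0 else (h %% n).+1.
  rewrite {1}(divn_eq h n) -addnS modnMDl; case: eqP => [->|]; first by rewrite modnn.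
  by move=> ne; rewrite modn_small //; lia.
have hSkn : (h %% n).+1 != n -> h.+1 < k * n.
  move=> ne; rewrite ltn_neqAle hkn andbT; apply: contra ne => /eqP hE.
  by move: hS; rewrite hE modnMl; case: eqP.
rewrite !andbT /dvdn hS.
have [tE|tE] := eqVneq (h %% n).+1 n.
- rewrite /= [X in _ -> is_true X -> _]ltn_straight //.
  have [t0|t0] := eqVneq (h %% n) 0.
    rewrite t0 /= ltn_straight //; lia.
  rewrite lt0n (negbTE t0) /= ltn_lex; try (case: ifP; lia).
  by case: ifP; case: ifP; lia.
- rewrite /= hSkn //= [X in _ -> is_true X -> _]ltn_lex; try (case: ifP; lia).
  have [t0|t0] := eqVneq (h %% n) 0.
    rewrite t0 /= ltn_straight //; case: ifP; case: ifP; lia.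
  rewrite lt0n (negbTE t0) /= ltn_lex; try (case: ifP; lia).
  by case: ifP; case: ifP; lia.
Qed.

(** The bundles at height [h] that descend from bundle 0 at height 0 have the
    numbers below [2 ^ nbits h]. *)
Definition nbits (h : nat) : nat := \sum_(g < h) splits g.

Lemma nbitsS (h : nat) : nbits h.+1 = nbits h + splits h.
Proof. exact: big_ord_recr. Qed.

Lemma nbits_mono (h g : nat) : nbits h <= nbits (h + g).
Proof.
elim: g => [|g IH]; first by rewrite addn0.
by rewrite addnS nbitsS (leq_trans IH) ?leq_addr.
Qed.

Lemma nbits_block (j : nat) : j <= k -> j <= nbits (j * n).
Proof.
elim: j => // j IH jk.
have -> : j.+1 * n = (j * n).+1 + n.-1 by lia.
apply: leq_trans (nbits_mono _ _).
by rewrite nbitsS /splits dvdn_mull // ltn_pmul2r // jk addn1 ltnS IH // ltnW.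
Qed.

Lemma leq_parent (h q : nat) : parent h q <= q.
Proof. by rewrite /parent; case: ifP; lia. Qed.

Lemma parent_bits (h q : nat) :
  q < 2 ^ nbits h.+1 -> parent h q < 2 ^ nbits h.
Proof.
rewrite nbitsS /parent; case: (splits h); last by rewrite addn0.
by rewrite addn1 expnS; lia.
Qed.

(** * The graph of the wires *)

(** A vertex has a height, a bundle number and a wire number.  For uniformity all
    bundle numbers below [2 ^ k] are present at every height, and all wire
    numbers at the top; the surplus vertices lie in components of the graph that
    contain neither a root nor a leaf. *)
Definition wire_vertex : finType := ('I_r.+1 * 'I_#|{set 'I_k}| * 'I_k)%type.
Definition height (v : wire_vertex) : nat := v.1.1.
Definition bundle (v : wire_vertex) := v.1.2.
Definition wire (v : wire_vertex) := v.2.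

Lemma vertex_eq (u v : wire_vertex) :
  height u = height v -> bundle u = bundle v :> nat -> wire u = wire v :> nat ->
  u = v.
Proof.
case: u v => [[h q] i] [[h' q'] i'] hE qE iE.
by congr (_, _, _); apply: val_inj.
Qed.

(** Bundle [q] just below the top height is the end that stands for the subset of
    number [q]; the vertex above it has wire number 0 by convention. *)
Definition up (u v : wire_vertex) : bool :=
  (height v == (height u).+1) &&
  if height v == r
  then [&& bundle u == bundle v, wire v == ord0 & wire u \in enum_val (bundle v)]
  else (wire u == wire v) && (bundle u == parent (height u) (bundle v) :> nat).

Definition wire_adj (u v : wire_vertex) : bool := up u v || up v u.

Lemma wire_adj_sym : symmetric wire_adj.
Proof. by move=> u v; rewrite /wire_adj orbC. Qed.

Lemma wire_adj_irr : irreflexive wire_adj.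
Proof. by move=> u; rewrite /wire_adj /up orbb -[X in X == _]addn0 -addn1 eqn_add2l. Qed.

Definition wire_graph : sgraph := SGraph wire_adj_sym wire_adj_irr.

Lemma up_height (u v : wire_vertex) : up u v -> height v = (height u).+1.
Proof. by case/andP => /eqP. Qed.

Lemma up_below (u v : wire_vertex) : up u v -> height v != r ->
  wire u = wire v /\ bundle u = parent (height u) (bundle v) :> nat.
Proof. by case/andP => _ + /negbTE hv; rewrite hv => /andP[/eqP -> /eqP]. Qed.

Lemma up_top (u v : wire_vertex) : up u v -> height v = r ->
  [/\ bundle u = bundle v, wire v = ord0 & wire u \in enum_val (bundle v)].
Proof. by case/andP => _ + hv; rewrite hv eqxx => /and3P[/eqP -> /eqP ->]. Qed.

Definition abscissa (v : wire_vertex) : nat := slot (height v) (bundle v) (wire v).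

Lemma straight (h q i : nat) : k * n <= h ->
  slot h q i = q * (8 * k) + (4 * i + 2 * k).
Proof. by move=> hkn; rewrite /slot [h < _]ltnNge hkn andbF. Qed.

(** No crossing occurs in the top layer: its edges keep their bundle, and those
    of one bundle meet at the top. *)
Lemma up_inverted (u v u' v' : wire_vertex) : up u v -> up u' v' ->
  height u' = height u ->
  abscissa u < abscissa u' -> abscissa v' < abscissa v ->
  height v != r /\
  [&& (bundle v)./2 == (bundle v')./2, odd (bundle v), ~~ odd (bundle v')
    & wire v' == wire v + (height u %% n).+1 :> nat].
Proof.
move=> uv uv' hE; have hv := up_height uv; have hv' := up_height uv'.
have hvE : height v' = height v by rewrite hv hv' hE.
have [vr|vr] := eqVneq (height v) r.
  have [nE wE _] := up_top uv vr.
  have [nE' wE' _] := up_top uv' (etrans hvE vr).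
  rewrite /abscissa !straight; try lia.
  by rewrite nE nE' wE wE' /= !ltn_straight //=; lia.
have [wE nE] := up_below uv vr.
have [wE' nE'] := up_below uv' (eq_ind_r (fun m => m != r) vr hvE).
rewrite /abscissa hE hv' hE hv nE nE' wE wE' hE => lo hi.
by split=> //; exact: slot_inverted (ltn_ord _) (ltn_ord _) lo hi.
Qed.

(** The partner of an edge in a crossing is determined: it belongs to the other
    half of the same bundle, and its wire number differs by [t + 1], upwards
    from a right branch and downwards from a left branch. *)
Lemma wire_graph_one_planar (R : realType) : one_planar R wire_graph.
Proof.
apply: (@LayeredDrawing.layered_one_planar R wire_graph abscissa height).
- move=> u v + hE; rewrite /abscissa hE => /(slot_inj (ltn_ord _) (ltn_ord _)).
  by case=> qE iE; apply: vertex_eq.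
- move=> u v uv; case/orP: (uv) => /[dup] E /up_height; [left|right] => //.
  by split=> //; rewrite /adj /= wire_adj_sym.
move=> u v u1 v1 u2 v2.
have up_of (a b : wire_graph) : @LayeredDrawing.up_edge wire_graph height a b -> up a b.
  by case=> /orP[//|/up_height -> E]; lia.
move=> /up_of uv /up_of uv1 /up_of uv2 h1 h2.
have hv := up_height uv; have hv1 := up_height uv1; have hv2 := up_height uv2.
have same_edge : height v != r ->
    bundle v1 = bundle v2 :> nat -> wire v1 = wire v2 :> nat -> u1 = u2 /\ v1 = v2.
  move=> vr nE wE; have vE : v1 = v2 by apply: vertex_eq => //; lia.
  have v1r : height v1 != r by rewrite hv1 h1 -hv.
  have [wE1 nE1] := up_below uv1 v1r.
  have v2r : height v2 != r by rewrite -vE.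
  have [wE2 nE2] := up_below uv2 v2r.
  split=> //; apply: vertex_eq; rewrite ?h1 ?h2 //.
    by rewrite nE1 nE2 h1 h2 vE.
  by rewrite wE1 wE2 vE.
case=> -[lo1 hi1] [] [lo2 hi2].
- have [vr I1] := up_inverted uv uv1 h1 lo1 hi1.
  have [_ I2] := up_inverted uv uv2 h2 lo2 hi2.
  by apply: same_edge => //; lia.
- have [vr I1] := up_inverted uv uv1 h1 lo1 hi1.
  have [_] := up_inverted uv2 uv (esym h2) lo2 hi2; rewrite h2 => I2.
  by lia.
- have [_] := up_inverted uv1 uv (esym h1) lo1 hi1; rewrite h1 => I1.
  have [vr I2] := up_inverted uv uv2 h2 lo2 hi2.
  by lia.
- have [v1r] := up_inverted uv1 uv (esym h1) lo1 hi1; rewrite h1 => I1.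
  have [_] := up_inverted uv2 uv (esym h2) lo2 hi2; rewrite h2 => I2.
  have vr : height v != r by rewrite hv -h1 -hv1.
  by apply: same_edge => //; lia.
Qed.

(** * Traces of balls around the leaves *)

Lemma card_subsets : #|{set 'I_k}| = 2 ^ k.
Proof. by rewrite -cardsT -powersetT card_powerset cardsT card_ord. Qed.

Lemma card_subsets_gt0 : 0 < #|{set 'I_k}|.
Proof. by apply/card_gt0P; exists set0. Qed.

Definition root (i : 'I_k) : wire_graph := (ord0, Ordinal card_subsets_gt0, i).
Definition leaf (S : {set 'I_k}) : wire_graph := (ord_max, enum_rank S, ord0).
Definition roots : {set wire_graph} := [set root i | i in 'I_k].

Lemma root_inj : injective root.
Proof. by move=> i j []. Qed.

Lemma path_to_root (v : wire_graph) :
  height v < r -> bundle v < 2 ^ nbits (height v) ->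
  exists p, [/\ path wire_adj v p, last v p = root (wire v)
              & size p = height v].
Proof.
move: {-1}(height v) (erefl (height v)) => h.
elim: h v => [|h IH] v hE hr.
  rewrite /nbits big_ord0 => q0; exists [::]; split=> //=.
  by apply: vertex_eq => //=; lia.
move=> /parent_bits qh.
have hr1 : h < r.+1 by lia.
pose u : wire_graph :=
  (Ordinal hr1, Ordinal (leq_ltn_trans (leq_parent h (bundle v)) (ltn_ord (bundle v))),
   wire v).
have [p [upp lp sp]] := IH u erefl (ltnW hr) qh.
exists (u :: p); split=> //=; last by rewrite sp.
rewrite upp andbT /wire_adj orbC /up hE eqxx /= ifN ?eqxx //.
by apply/eqP; lia.
Qed.

(** Each step changes the height by 1, so a walk that reaches height 0 in at most
    [height v] steps goes down at every step, and going down preserves the wire. *)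
Lemma short_path_wire (v : wire_graph) (p : seq wire_graph) :
  path wire_adj v p -> height v < r -> size p <= height v ->
  height (last v p) = 0 -> wire (last v p) = wire v.
Proof.
elim: p v => // w p IH v /andP[/orP[vw|wv] wp] hr sp; rewrite last_cons => h0.
  have hw : height w <= height (last w p) + size p.
    apply: path_height wp => u u' /orP[] /up_height; lia.
  have {}sp : size p < height v := sp.
  by rewrite (up_height vw) h0 add0n in hw; rewrite ltnNge ltnW in sp.
have hv := up_height wv.
have vr : height v != r by rewrite ltn_eqF.
have {}sp : size p < height v := sp.
have [<- _] := up_below wv vr.
rewrite hv in hr sp.
exact: IH (ltnW hr) sp h0.
Qed.

(** The leaf is at height [r], so a walk to a root uses all [r] steps to descend:
    its first step selects a wire of [S] and the others stay on that wire. *)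
Lemma ball_leaf (S : {set 'I_k}) : ball r (leaf S) :&: roots = root @: S.
Proof.
apply/setP => a; rewrite inE; apply/andP/imsetP => [[/ballP[p [lp pa pr]]]|].
  case/imsetP => i _ aE; exists i => //.
  case: p lp pa pr => [_ pa _|w p].
    by have : r = 0 := congr1 height (etrans pa aE); lia.
  case/andP => /orP[/up_height hw|wv wp pa pr].
    have {}hw : nat_of_ord w.1.1 = r.+1 := hw.
    by have := ltn_ord w.1.1; rewrite hw ltnn.
  have hw : r = (height w).+1 := up_height wv.
  have [nE _] := up_top wv erefl.
  rewrite enum_rankK; suff -> : wire w = i by [].
  rewrite -[i]/(wire (root i)) -aE -pa; apply/esym.
  apply: short_path_wire wp _ _ _; first by rewrite hw.
    by rewrite -ltnS -hw.
  by rewrite [last w p]pa aE.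
case=> i iS ->; split; last exact: imset_f.
have r1r : r.-1 < r.+1 by lia.
pose u : wire_graph := (Ordinal r1r, enum_rank S, i).
have uv : up u (leaf S).
  rewrite /up /leaf /height /bundle /wire /= !eqxx enum_rankK iS andbT /=.
  by apply/eqP; lia.
have [||p [pp lp sp]] := @path_to_root u.
- by rewrite /height /=; lia.
- apply: leq_trans (ltn_ord _) _; rewrite card_subsets leq_pexp2l //.
  rewrite [height u](_ : _ = k * n + n.-1); last by rewrite /height /=; lia.
  exact: leq_trans (nbits_block (leqnn k)) (nbits_mono _ _).
apply/ballP; exists (u :: p); split=> //=.
  by rewrite pp andbT /wire_adj uv orbT.
by rewrite sp /height /=; lia.
Qed.

Lemma card_roots : #|roots| = k.
Proof. by rewrite card_imset ?card_ord //; apply: root_inj. Qed.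

Lemma card_traces : 2 ^ k <= #|[set ball r v :&: roots | v in [set: wire_graph]]|.
Proof.
have -> : 2 ^ k = #|[set root @: S | S : {set 'I_k}]|.
  by rewrite card_imset ?card_subsets //; apply: imset_inj root_inj.
apply/subset_leq_card/subsetP => _ /imsetP[S _ ->].
by rewrite -ball_leaf; apply: imset_f; rewrite inE.
Qed.
End Construction.

Theorem theorem38 (R : realType) (r : nat) (hr : (0 < r)%N)
    (hsq : exists k : nat, (r + 1 = k ^ 2)%N) :
  exists (G : sgraph) (A : {set G}),
    [/\ one_planar R G, A != set0 &
        2 `^ Num.sqrt (r + 1)%:R / Num.sqrt (r + 1)%:R * #|A|%:R
          <= #|[set ball r v :&: A | v in [set: G]]|%:R :> R].
Proof.
case: hsq => k kE.
(* r > 0 excludes k = 1, for which a splitting would have no layers *)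
have [n [n_gt0 kn rE]] : exists n, [/\ (0 < n)%N, k = n.+1 & r = (n * n.+2)%N].
  by case: k kE => [|n] kE; [lia|exists n; split; nia].
subst r; exists (wire_graph n), (roots n); split.
- exact: wire_graph_one_planar.
- by rewrite -card_gt0 card_roots.
rewrite kE natrX sqrtr_sqr ger0_norm ?ler0n // powR_mulrn // -natrX card_roots -kn.
rewrite divfK ?pnatr_eq0 ?kn // ler_nat; exact: card_traces.
Qed.
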